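(* Let $(X,d)$ be a controlled metric type space with control function $\alpha : X\times X\to[1,\infty)$, let $r\ge 0$ be a real number, and let $\{x_n\}_{n\in\mathbb N}$ be a sequence in $X$. If $\sup_{x,y\in X}\alpha(x,y)$ exists (is finite), then $LIM^{r}x_n$ is a bounded set.
   Context: A controlled metric type space is a nonempty set $X$ with functions $\alpha: X\times X\to[1,\infty)$ and $d:X\times X\to[0,\infty)$ such that for all $x,y,z\in X$: $d(x,y)=0$ iff $x=y$; $d(x,y)=d(y,x)$; and $d(x,y)\le \alpha(x,z)d(x,z)+\alpha(z,y)d(z,y)$. (No symmetry of $\alpha$ is assumed.) For a real $r\ge0$, a sequence $\{x_n\}$ in $X$ is $r$-convergent (rough convergent of roughness degree $r$) to $x\in X$ if for every $\varepsilon>0$ there is $n_0\in\mathbb N$ with $d(x_n,x)<r+\varepsilon$ for all $n\ge n_0$. The $r$-limit set $LIM^{r}x_n$ is the set of all $x\in X$ to which $\{x_n\}$ is $r$-convergent. A set $A\subseteq X$ is bounded if there is a real $M$ with $d(x,y)\le M$ for all $x,y\in A$. *)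

(* Defs.v *)
From Stdlib Require Import Reals.

Open Scope R_scope.

(* [alpha] is not assumed symmetric, so the order of its arguments in
   [dist_triangle] matters. *)
Record controlled_metric_type_space : Type := {
  carrier :> Type;
  alpha : carrier -> carrier -> R;
  dist : carrier -> carrier -> R;
  carrier_inhabited : inhabited carrier;
  alpha_ge1 : forall x y, 1 <= alpha x y;
  dist_ge0 : forall x y, 0 <= dist x y;
  dist_eq0 : forall x y, dist x y = 0 <-> x = y;
  dist_sym : forall x y, dist x y = dist y x;
  dist_triangle : forall x y z,
    dist x y <= alpha x z * dist x z + alpha z y * dist z y
}.

Arguments alpha {_} _ _.
Arguments dist {_} _ _.

Definition rough_convergent {X : controlled_metric_type_space}
    (r : R) (u : nat -> X) (x : X) : Prop :=
  forall eps : R, 0 < eps ->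
    exists n0 : nat, forall n : nat, (n0 <= n)%nat -> dist (u n) x < r + eps.

Definition LIM {X : controlled_metric_type_space}
    (r : R) (u : nat -> X) : X -> Prop :=
  fun x => rough_convergent r u x.

Definition bounded_set {X : controlled_metric_type_space} (A : X -> Prop) : Prop :=
  exists M : R, forall x y : X, A x -> A y -> dist x y <= M.

Definition alpha_values (X : controlled_metric_type_space) : R -> Prop :=
  fun a => exists x y : X, a = alpha x y.

(* Main.v *)
Require Import Defs.
From Stdlib Require Import Reals.
From Stdlib Require Import Lra Lia.
Open Scope R_scope.

(** Taking [eps = 1], any two rough limits [x], [y] lie within [r + 1] of one common late term [z]
    of the sequence. The triangle inequality through [z] has two terms, each at most [s * (r + 1)]
    with [s] the supremum of [alpha], and this bound does not depend on [x] and [y]. *)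

Theorem corollary3p5 (X : controlled_metric_type_space) (r : R) (u : nat -> X)
  (hr : 0 <= r)
  (hsup : exists s : R, is_lub (alpha_values X) s) :
  bounded_set (LIM r u).
Proof.
  destruct hsup as [s [hub _]].
  exists (2 * s * (r + 1)).
  intros x y hx hy.
  destruct (hx 1 Rlt_0_1) as [n1 h1].
  destruct (hy 1 Rlt_0_1) as [n2 h2].
  set (z := u (Nat.max n1 n2)).
  assert (hzx : Defs.dist z x < r + 1) by (apply h1; lia).
  assert (hzy : Defs.dist z y < r + 1) by (apply h2; lia).
  (* The arguments of [alpha] and [dist] are decoupled: symmetry will turn [dist x z] into
     [dist z x], while the factor [alpha x z] has to stay as it is. *)
  assert (term_le : forall a b c d : X,
            Defs.dist c d < r + 1 -> alpha a b * Defs.dist c d <= s * (r + 1)).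
  { intros a b c d hcd.
    apply Rmult_le_compat.
    - pose proof (alpha_ge1 X a b); lra.
    - apply Defs.dist_ge0.
    - apply hub; now exists a, b.
    - now apply Rlt_le. }
  pose proof (Defs.dist_triangle X x y z) as htri.
  rewrite (Defs.dist_sym X x z) in htri.
  pose proof (term_le x z z x hzx).
  pose proof (term_le z y z y hzy).
  lra.
Qed.
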